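(* For any qualitative necessity ordering $\geq_N$ (on sentences of $\mathbf{L}_{CPL}$) there is a CO-model $M$ determining the corresponding entrenchment ordering: for all $A,B\in\mathbf{L}_{CPL}$, $A\geq_{EM}B$ iff $A\geq_N B$, where $A\geq_{EM}B$ means $B\leq_{EM}A$.
   Context: Language: $\mathbf{P}$ is a denumerable set of propositional variables; $\mathbf{L}$ is the language built from $\mathbf{P}$ with connectives $\neg,\supset$ (material implication), $\Box$ and $\overleftarrow{\Box}$ (both unary modal operators), with $\wedge,\vee,\equiv,\top,\bot$ defined as usual. $\mathbf{L}_{CPL}$ is the purely propositional (modality-free) sublanguage. Qualitative necessity ordering: any binary relation $\geq_N$ on the sentences of $\mathbf{L}_{CPL}$ ($A\geq_N B$ is read ''$A$ is at least as necessary as $B$'') satisfying the following postulates for all $A,B,C$: (N1) $A \geq_N A$; (N2) $A \geq_N B$ or $B \geq_N A$; (N3) if $A \geq_N B$ and $B \geq_N C$ then $A \geq_N C$; (N4) $\top >_N \bot$ (i.e. $\top\geq_N\bot$ and not $\bot\geq_N\top$); (N5) $\top \geq_N A$ for all $A$; (N6) if $B \geq_N C$ then $A \wedge B \geq_N A \wedge C$ for all $A$. CO-model: a triple $M=\langle W,R,\varphi\rangle$ where $W$ is a set (of possible worlds), $R$ is a binary relation on $W$ that is transitive and totally connected (for all $v,w\in W$, $wRv$ or $vRw$; in particular $R$ is reflexive), and $\varphi:\mathbf{P}\to 2^W$ ($\varphi(A)$ is the set of worlds where $A$ is true). Truth at a world: $M\models_w\alpha$ is defined as usual for variables and classical connectives;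 $M\models_w\Box\alpha$ iff $M\models_v\alpha$ for every $v$ with $wRv$; $M\models_w\overleftarrow{\Box}\alpha$ iff $M\models_v\alpha$ for every $v$ such that not $wRv$. $M\models\alpha$ means $M\models_w\alpha$ for every $w\in W$. Abbreviations: $\Diamond\alpha:=\neg\Box\neg\alpha$ and $\overleftrightarrow{\Box}\alpha:=\Box\alpha\wedge\overleftarrow{\Box}\alpha$ (so $\overleftrightarrow{\Box}\alpha$ holds at a world iff $\alpha$ holds at all worlds of $W$). Plausibility ordering determined by $M$: $A\leq_{PM}B$ iff $M\models\overleftrightarrow{\Box}(B\supset\Diamond A)$. Entrenchment ordering determined by $M$: $B\leq_{EM}A$ iff $\neg B\leq_{PM}\neg A$; equivalently, $M\models\overleftrightarrow{\Box}(\neg A\supset\Diamond\neg B)$.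
   Formalization: The ordering is additionally assumed invariant under classical logical equivalence of sentences; (N1)–(N6) read purely syntactically do not imply this, and the claim fails without it, since every entrenchment ordering has this invariance. *)

(* Defs.v *)
From mathcomp Require Import all_boot.

Set Implicit Arguments.
Unset Strict Implicit.
Unset Printing Implicit Defensive.

Definition denumerable (P : Type) : Prop := exists f : nat -> P, bijective f.

Inductive form (P : Type) : Type :=
| Var of P
| Neg of form P
| Imp of form P & form P
| Box of form P
| LBox of form P.  (* the operator written with a left-pointing arrow *)

Definition And P (a b : form P) : form P := Neg (Imp a (Neg b)).
Definition Dia P (a : form P) : form P := Neg (Box (Neg a)).
Definition BiBox P (a : form P) : form P := And (Box a) (LBox a).

(* The modality-free sublanguage, embedded in [form P] by [form_of_cpl]. *)
Inductive cpl (P : Type) : Type :=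
| CVar of P
| CNeg of cpl P
| CImp of cpl P & cpl P.

Fixpoint form_of_cpl P (A : cpl P) : form P :=
  match A with
  | CVar p => Var p
  | CNeg A1 => Neg (form_of_cpl A1)
  | CImp A1 A2 => Imp (form_of_cpl A1) (form_of_cpl A2)
  end.

Coercion form_of_cpl : cpl >-> form.

Definition CAnd P (A B : cpl P) : cpl P := CNeg (CImp A (CNeg B)).

(* Only negation and implication are primitive, so the constants have to be
   built from some variable [p0]. *)
Definition CTop P (p0 : P) : cpl P := CImp (CVar p0) (CVar p0).
Definition CBot P (p0 : P) : cpl P := CNeg (CTop p0).

Fixpoint eval P (v : P -> bool) (A : cpl P) : bool :=
  match A with
  | CVar p => v p
  | CNeg A1 => ~~ eval v A1
  | CImp A1 A2 => eval v A1 ==> eval v A2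
  end.

Definition logically_equivalent P (A B : cpl P) : Prop :=
  forall v : P -> bool, eval v A = eval v B.

Record necessity_ordering P (p0 : P) (ge : cpl P -> cpl P -> Prop) : Prop :=
  NecessityOrdering {
    N1 : forall A, ge A A;
    N2 : forall A B, ge A B \/ ge B A;
    N3 : forall A B C, ge A B -> ge B C -> ge A C;
    N4 : ge (CTop p0) (CBot p0) /\ ~ ge (CBot p0) (CTop p0);
    N5 : forall A, ge (CTop p0) A;
    N6 : forall A B C, ge B C -> ge (CAnd A B) (CAnd A C)
  }.

(* (N1)-(N6) are postulates about propositions: sentences are taken up to
   classical equivalence.  This does not follow from (N1)-(N6) themselves: the
   ordering whose only sentence of top rank is, syntactically, [CTop p0], all
   other sentences being tied below it, satisfies all six. *)
Definition respects_equivalence P (ge : cpl P -> cpl P -> Prop) : Prop :=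
  forall A A' B B', logically_equivalent A A' -> logically_equivalent B B' ->
    ge A B -> ge A' B'.

Record co_model (P : Type) : Type := COModel {
  world : Type;
  acc : world -> world -> Prop;
  valuation : P -> world -> Prop;
  acc_trans : forall u v w, acc u v -> acc v w -> acc u w;
  acc_total : forall v w, acc v w \/ acc w v
}.

Fixpoint sat P (M : co_model P) (w : world M) (a : form P) : Prop :=
  match a with
  | Var p => valuation p w
  | Neg b => ~ sat w b
  | Imp b c => sat w b -> sat w c
  | Box b => forall v : world M, acc w v -> sat v b
  | LBox b => forall v : world M, ~ acc w v -> sat v b
  end.

Definition holds P (M : co_model P) (a : form P) : Prop :=
  forall w : world M, sat w a.

(* [le_plaus M A B]: A is at least as plausible as B. *)
Definition le_plaus P (M : co_model P) (A B : form P) : Prop :=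
  holds M (BiBox (Imp B (Dia A))).

(* [le_ent M B A]: A is at least as entrenched as B. *)
Definition le_ent P (M : co_model P) (B A : form P) : Prop :=
  le_plaus M (Neg B) (Neg A).

Definition ge_ent P (M : co_model P) (A B : form P) : Prop := le_ent M B A.

(* Main.v *)
(** The worlds are the valuations satisfying every sentence of top rank, and a
    world [w] sees [v] when every sentence false at [v] is at most as necessary
    as some sentence false at [w].  By (N5)-(N6), the complement of a downward
    closed set of sentences of non-top rank is a deductively closed theory, so
    any sentence outside this theory is falsified by one of its models.  This
    is applied to the sentences below some sentence false at [w], to find the
    world required for [ge_ent], and to the sentences below [A], to refute
    [ge_ent A B] when [B] is strictly more necessary than [A]. *)
Require Import Defs.
From mathcomp Require Import all_boot.
From Stdlib Require Import Classical ClassicalEpsilon.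

Set Implicit Arguments.
Unset Strict Implicit.
Unset Printing Implicit Defensive.

Lemma eval_CAnd P (v : P -> bool) (A B : cpl P) :
  eval v (CAnd A B) = eval v A && eval v B.
Proof. by rewrite /=; case: (eval v A); case: (eval v B). Qed.

Lemma eval_CTop P (p0 : P) (v : P -> bool) : eval v (CTop p0).
Proof. exact: implybb. Qed.

Definition entails P (A B : cpl P) : Prop :=
  forall v : P -> bool, eval v A -> eval v B.

(** One-premise entailment together with conjunction gives closure under entailment from finitely
    many premises. *)
Record theory P (S : cpl P -> Prop) : Prop := Theory {
  theory_inhabited : exists A, S A;
  theory_and : forall A B, S A -> S B -> S (CAnd A B);
  theory_entails : forall A B, S A -> entails A B -> S B
}.

Section Compactness.

Variables (P : Type) (f : nat -> P) (g : P -> nat).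
Hypotheses (fK : cancel f g) (gK : cancel g f).

Lemma eval_local (A : cpl P) : exists n, forall u v : P -> bool,
  (forall i, i < n -> u (f i) = v (f i)) -> eval u A = eval v A.
Proof.
elim: A => [p|A [n IHA]|A [n IHA] B [m IHB]] /=.
- by exists (g p).+1 => u v uv; rewrite -(gK p) uv.
- by exists n => u v uv; rewrite (IHA u v).
- exists (maxn n m) => u v uv.
  rewrite (IHA u v); last by move=> i lt_in; rewrite uv // leq_max lt_in.
  by rewrite (IHB u v) // => i lt_im; rewrite uv // leq_max lt_im orbT.
Qed.

Variables (S : cpl P -> Prop) (B : cpl P).
Hypotheses (thS : theory S) (notSB : ~ S B).

(* The single sentences of [S] stand for its finite subsets, as [S] is closed
   under conjunction. *)
Definition extendible (s : seq bool) : Prop :=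
  forall C, S C -> exists u : P -> bool,
    [/\ mkseq (u \o f) (size s) = s, eval u C & ~~ eval u B].

Lemma extendible_nil : extendible [::].
Proof.
move=> C SC; apply: NNPP => no_u; apply: notSB.
apply: (theory_entails thS SC) => u uC; apply/negPn/negP => uB.
by apply: no_u; exists u.
Qed.

(** If [C1] and [C2] blocked the two extensions, a valuation extending [s] for their conjunction
    would contradict one of them by its value at the next variable. *)
Lemma extendible_rcons s : extendible s ->
  extendible (rcons s true) \/ extendible (rcons s false).
Proof.
move=> ext_s; apply: NNPP => /not_or_and[].
move=> /not_all_ex_not[C1 no1] /not_all_ex_not[C2 no2].
have [SC1 no_u1] := imply_to_and _ _ no1.
have [SC2 no_u2] := imply_to_and _ _ no2.
have [u [us]] := ext_s _ (theory_and thS SC1 SC2).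
rewrite eval_CAnd => /andP[uC1 uC2] uB.
have us' : mkseq (u \o f) (size s).+1 = rcons s (u (f (size s))).
  by rewrite mkseqS us.
case: (u (f (size s))) us' => us'.
  by apply: no_u1; exists u; rewrite size_rcons.
by apply: no_u2; exists u; rewrite size_rcons.
Qed.

(** An infinite path through the tree of extendible prefixes, as in König's lemma, taking [true]
    whenever possible. *)
Fixpoint branch (n : nat) : seq bool :=
  if n is m.+1 then
    rcons (branch m)
      (if excluded_middle_informative (extendible (rcons (branch m) true))
       then true else false)
  else [::].

Lemma size_branch n : size (branch n) = n.
Proof. by elim: n => //= n IHn; rewrite size_rcons IHn. Qed.

Lemma extendible_branch n : extendible (branch n).
Proof.
elim: n => [|n IHn] /=; first exact: extendible_nil.
by case: excluded_middle_informative => // no_true; case: (extendible_rcons IHn).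
Qed.

Lemma nth_branch n i : i < n ->
  nth false (branch n) i = nth false (branch i.+1) i.
Proof.
elim: n => // n IHn; rewrite ltnS leq_eqVlt => /orP[/eqP -> //|lt_in].
by rewrite -(IHn lt_in) [branch n.+1]/= nth_rcons size_branch lt_in.
Qed.

(** The limit of the branches works: a sentence of [S] and [B] depend on finitely many variables, so
    a long enough branch decides both. *)
Lemma theory_countermodel :
  exists v : P -> bool, (forall C, S C -> eval v C) /\ ~~ eval v B.
Proof.
(* Stage [(g p).+1] is the first to have an entry at index [g p], so the default [false] is never
   read. *)
pose v p := nth false (branch (g p).+1) (g p).
have approx C : S C -> eval v C /\ ~~ eval v B.
  move=> SC; have [n locC] := eval_local C; have [m locB] := eval_local B.
  have [u [us uC uB]] := extendible_branch (maxn n m) SC.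
  have uv i : i < maxn n m -> u (f i) = v (f i).
    move=> lt_i; rewrite /v fK -(nth_branch lt_i) -us size_branch.
    by rewrite nth_mkseq.
  rewrite -(locC u v); last by move=> i lt_in; rewrite uv // leq_max lt_in.
  by rewrite -(locB u v) // => i lt_im; rewrite uv // leq_max lt_im orbT.
have [C SC] := theory_inhabited thS.
by exists v; split=> [D /approx[]|] //; case: (approx C SC).
Qed.

End Compactness.

Section NecessityOrdering.

Variables (P : Type) (p0 : P) (geN : cpl P -> cpl P -> Prop).
Hypotheses (hN : necessity_ordering p0 geN) (hE : respects_equivalence geN).

(** Conjoining [B] to both sides of (N5) compares [B] and top with [B] and [A], which are equivalent
    to [B] and to [A]. *)
Lemma entails_ge (A B : cpl P) : entails A B -> geN B A.
Proof.
move=> AB; apply: (hE _ _ (N6 hN B (N5 hN A))) => v; rewrite eval_CAnd.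
  by rewrite eval_CTop andbT.
by case vA: (eval v A); rewrite ?andbF // AB.
Qed.

Lemma ge_CAnd (A B : cpl P) : geN A B -> geN (CAnd A B) B.
Proof.
move=> AB; apply: (hE _ _ (N6 hN B AB)) => v; rewrite !eval_CAnd.
  exact: andbC.
exact: andbb.
Qed.

Definition down_closed (X : cpl P -> Prop) : Prop :=
  forall A B, X A -> geN A B -> X B.

(** A conjunction ranks at least as high as its lesser conjunct, so if it lies in [X], so does that
    conjunct. *)
Lemma theory_complement (X : cpl P -> Prop) :
  down_closed X -> ~ X (CTop p0) -> theory (fun A => ~ X A).
Proof.
move=> downX notXtop; split=> [|A B notXA notXB XAB|A B notXA AB XB].
- by exists (CTop p0).
- case: (N2 hN A B) => [AB | BA].
    by apply: notXB; apply: downX XAB (ge_CAnd AB).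
  apply: notXA; apply: downX XAB _; apply: (hE _ _ (ge_CAnd BA)) => // v.
  by rewrite !eval_CAnd andbC.
- by apply: notXA; apply: downX XB (entails_ge AB).
Qed.

(** The down-closed set generated by the sentences false at [v]. *)
Definition below_false (v : P -> bool) (A : cpl P) : Prop :=
  exists2 B, ~~ eval v B & geN B A.

Lemma below_false_down v : down_closed (below_false v).
Proof. by move=> A B [C vC CA] AB; exists C => //; apply: N3 hN _ _ _ CA AB. Qed.

Lemma below_false_incl (v : P -> bool) (X : cpl P -> Prop) :
  down_closed X -> (forall A, ~ X A -> eval v A) ->
  forall A, below_false v A -> X A.
Proof.
move=> downX sat_v A [B vB BA]; apply: downX BA; apply: NNPP => /sat_v.
exact/negP.
Qed.

Definition top_world : Type := {v : P -> bool | ~ below_false v (CTop p0)}.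

Definition top_acc (w v : top_world) : Prop :=
  forall A, below_false (sval v) A -> below_false (sval w) A.

Lemma top_acc_trans u v w : top_acc u v -> top_acc v w -> top_acc u w.
Proof. by move=> uv vw A /vw /uv. Qed.

(** Down-closed sets of a total preorder are nested. *)
Lemma top_acc_total v w : top_acc v w \/ top_acc w v.
Proof.
apply: NNPP => /not_or_and[].
move=> /not_all_ex_not[A noA] /not_all_ex_not[B noB].
have [wA vA] := imply_to_and _ _ noA.
have [vB wB] := imply_to_and _ _ noB.
by case: (N2 hN A B) => [/(below_false_down wA)|/(below_false_down vB)].
Qed.

Definition entrenchment_model : co_model P :=
  COModel (fun p (w : top_world) => sval w p) top_acc_trans top_acc_total.

End NecessityOrdering.

Lemma sat_cpl P (p0 : P) geN (hN : necessity_ordering p0 geN)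
    (w : world (entrenchment_model hN)) (A : cpl P) :
  sat w A <-> eval (sval w) A.
Proof.
elim: A => [p|A IHA|A IHA B IHB] //=; first by rewrite IHA; split=> /negP.
by rewrite IHA IHB; split=> /implyP.
Qed.

Lemma holds_BiBox P (M : co_model P) (a : form P) :
  holds M (BiBox a) <-> holds M a.
Proof.
split=> [Ma w | Ma w /= Mna].
  (* Totality makes [acc] reflexive, so [Box a] at [w] already yields [a] at [w]. *)
  by apply: NNPP => not_a; apply: (Ma w) => box_a; case: not_a; apply: box_a;
     case: (acc_total w w).
by apply: Mna => v _; apply: Ma.
Qed.

Lemma ge_entP P (M : co_model P) (A B : form P) :
  ge_ent M A B <->
  forall w : world M, ~ sat w A -> exists2 v : world M, acc w v & ~ sat v B.
Proof.
rewrite /ge_ent /le_ent /le_plaus holds_BiBox; split=> AB w /= wA.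
  by apply: NNPP => no_v; apply: (AB w wA) => v wv vB; apply: no_v; exists v.
by case: (AB w wA) => v wv vB /(_ v wv).
Qed.

Theorem theorem4 (P : Type) (hP : denumerable P) (p0 : P)
    (geN : cpl P -> cpl P -> Prop)
    (hN : necessity_ordering p0 geN)
    (hE : respects_equivalence geN) :
  exists M : co_model P, forall A B : cpl P, ge_ent M A B <-> geN A B.
Proof.
(* The valuation is a countermodel to [C] of the complement of [X]; it is a world because its
   [below_false] set lies in [X], which misses top. *)
have down_world X C : down_closed geN X -> ~ X (CTop p0) -> X C ->
    exists2 v : world (entrenchment_model hN),
      ~ sat v C & forall D, below_false geN (sval v) D -> X D.
  move=> downX notXtop XC; have [f [g fK gK]] := hP.
  have notnotXC : ~ ~ X C by move/(_ XC).
  have [v [vX vC]] := theory_countermodel fK gK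
    (theory_complement hN hE downX notXtop) notnotXC.
  have v_incl := below_false_incl downX vX.
  exists (exist _ v (fun vtop => notXtop (v_incl _ vtop))) => //.
  by rewrite sat_cpl; apply/negP.
exists (entrenchment_model hN) => A B; rewrite ge_entP; split=> [AB|AB w].
- apply: NNPP => notAB.
  have downA : down_closed geN (geN A) by move=> C D; apply: (N3 hN).
  (* Otherwise [A] would be above top, hence above [B]. *)
  have notAtop : ~ geN A (CTop p0).
    by move=> Atop; apply: notAB; apply: N3 hN _ _ _ Atop (N5 hN B).
  have [w wA belowA] := down_world _ _ downA notAtop (N1 hN A).
  have [v wv] := AB w wA; rewrite sat_cpl => /negP vB.
  (* [B] is false at [v], so it is in the set of [v], hence in that of [w], hence below [A]. *)
  by apply/notAB/belowA/wv; exists B => //; apply: N1 hN B.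
- rewrite sat_cpl => /negP wA.
  have wB : below_false geN (sval w) B by exists A.
  (* With [X] the [below_false] set of [w], the inclusion obtained is exactly accessibility of [v]
     from [w]. *)
  have [v vB wv] := down_world _ _ (@below_false_down _ _ _ hN _) (svalP w) wB.
  by exists v.
Qed.
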